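(* Let $\{X_i\}$ be a zero-mean (real-valued, not necessarily stationary) process with finite second moments. For $n\in\mathbb{N}$ and $k\in\{1,\dots,n\}$ define the normalized $k$-out-of-$n$ trace--inverse $$M_k^{(n)}\triangleq\frac{1}{\binom nk}\sum_{\mathcal{S}\subseteq\{1,\dots,n\}:\,|\mathcal{S}|=k}\frac1k\operatorname{trace}\{\mathbf{C}_{\mathcal{S}}^{-1}\}.$$ Then for every fixed $n\in\mathbb{N}$ the sequence $\{M_k^{(n)}\mid k\in\{1,\dots,n\}\}$ is monotonically non-decreasing in $k$; that is, $$M_k^{(n)}\le M_{k+1}^{(n)}\qquad\text{for all } n\in\mathbb{N}\text{ and all }k\in\{1,\dots,n-1\}.$$
   Context: For a finite set $\mathcal{S}=\{i_1<i_2<\dots<i_{|\mathcal{S}|}\}$ of indices, $\mathbf{C}_{\mathcal{S}}\triangleq\mathbb{E}\{\boldsymbol{X}_{\mathcal{S}}\boldsymbol{X}_{\mathcal{S}}^T\}$ is the covariance matrix of the vector $\boldsymbol{X}_{\mathcal{S}}=(X_{i_1},\dots,X_{i_{|\mathcal{S}|}})^T$. Convention: $\operatorname{trace}\{\mathbf{A}^{-1}\}\triangleq\infty$ for a singular positive semidefinite matrix $\mathbf{A}$ (so $M_k^{(n)}$ may equal $\infty$). *)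

(* Defs.v *)
From HB Require Import structures.
From mathcomp Require Import all_boot all_order all_algebra.
From mathcomp Require Import all_classical all_reals all_analysis.
Set Implicit Arguments.
Unset Strict Implicit.
Unset Printing Implicit Defensive.
Import Order.TTheory GRing.Theory Num.Theory.
Local Open Scope ring_scope.

(* Convention: trace {A^-1} = +oo when A is singular. *)
Definition trace_inv (R : realType) (m : nat) (A : 'M[R]_m) : \bar R :=
  if A \in unitmx then (\tr (invmx A))%:E else +oo%E.

(* A set S : {set 'I_n} encodes the subset {s + 1 | s \in S} of {1, ..., n}.
   [enum_val : 'I_#|S| -> 'I_n] lists S in increasing order. For square
   integrable X the expectations below are finite, so [fine] loses nothing. *)
Definition cov_sub (d : measure_display) (T : measurableType d) (R : realType)
    (P : probability T R) (X : nat -> {RV P >-> R}) (n : nat) (S : {set 'I_n}) :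
    'M[R]_#|S| :=
  \matrix_(i < #|S|, j < #|S|)
    fine 'E_P[fun t => X (enum_val i : 'I_n).+1 t * X (enum_val j : 'I_n).+1 t].

Definition trace_inv_avg (d : measure_display) (T : measurableType d)
    (R : realType) (P : probability T R) (X : nat -> {RV P >-> R})
    (n k : nat) : \bar R :=
  (('C(n, k)%:R^-1 : R)%:E *
   \sum_(S : {set 'I_n} | #|S| == k)
     ((k%:R^-1 : R)%:E * trace_inv (cov_sub X S)))%E.

(* Main.v *)
(** For positive definite [A] and a principal submatrix [B = E A E^T], where the
    rows of [E] are unit vectors, [Z A Z^T = E A^-1 E^T - B^-1] is positive
    semidefinite for [Z = E A^-1 - B^-1 E]; hence the diagonal entries of
    [B^-1] sum to at most the corresponding diagonal entries of [A^-1].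
    Summing over the [k]-subsets of a [k+1]-set [S], each diagonal entry of
    [C_S^-1] is counted [k] times; summing over [S], each [k]-subset is counted
    [n - k] times. *)
Require Import Defs.
From HB Require Import structures.
From mathcomp Require Import all_boot all_order all_algebra.
From mathcomp Require Import all_classical all_reals all_analysis.
From mathcomp Require Import ring lra.
Import Order.TTheory GRing.Theory Num.Theory.
Local Open Scope ring_scope.

Definition psd {R : realType} {m : nat} (A : 'M[R]_m) : Prop :=
  A^T = A /\ forall x : 'rV[R]_m, 0 <= (x *m A *m x^T) 0 0.

(** With [y = x A], the form at [y - t x] is [q - 2 t s], where [s] is the squared norm of [y]; it
    is affine in [t] because the form vanishes at [x]. Nonnegativity for all [t] forces [s = 0],
    hence [x A = 0]. *)
Lemma psd_form_eq0 {R : realType} {m : nat} {A : 'M[R]_m} (x : 'rV[R]_m) :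
  psd A -> A \in unitmx -> (x *m A *m x^T) 0 0 = 0 -> x = 0.
Proof.
move=> [symA posA] uA qx.
have [y yE] : exists y, x *m A = y by exists (x *m A).
pose s : R := (y *m y^T) 0 0; pose q : R := (y *m A *m y^T) 0 0.
have sE : s = \sum_j y 0 j ^+ 2.
  by rewrite /s mxE; apply: eq_bigr => j _; rewrite mxE expr2.
have expand (t : R) : ((y - t *: x) *m A *m (y - t *: x)^T) 0 0 = q - t * s *+ 2.
  have yAx : (y *m A *m x^T) 0 0 = s.
    by rewrite -mulmxA -{1}symA -trmx_mul yE.
  have xAy : (x *m A *m y^T) 0 0 = s by rewrite yE.
  rewrite mulmxBl linearB /= linearZ /= mulmxBl !mulmxBr.
  rewrite -!scalemxAl -!scalemxAr.
  have entry (a b c e : 'M[R]_1) :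
      (a - t *: b - (t *: c - t *: (t *: e))) 0 0
        = a 0 0 - t * b 0 0 - (t * c 0 0 - t * (t * e 0 0)) by rewrite !mxE.
  by rewrite entry yAx xAy qx -/q; ring.
have q0 : 0 <= q by exact: posA.
have s0 : 0 <= s by rewrite sE; apply: sumr_ge0 => j _; exact: sqr_ge0.
have {}s0 : s = 0.
  apply/eqP/negPn/negP => sN0.
  (* At [t = (q + 1) / s] the form would equal [- q - 2 < 0]. *)
  have := posA (y - ((q + 1) / s) *: x).
  by rewrite expand divfK // mulr2n => h; clear -q0 h; lra.
have y0 : y = 0.
  apply/rowP => j; rewrite mxE; apply/eqP; rewrite -sqrf_eq0.
  have := s0; rewrite sE => /psumr_eq0P -> //.
  by move=> i _; exact: sqr_ge0.
by rewrite -(mulmxK uA x) yE y0 mul0mx.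
Qed.

Lemma psd_trace_ge0 {R : realType} {m p : nat} {A : 'M[R]_m} (Z : 'M[R]_(p, m)) :
  psd A -> 0 <= \tr (Z *m A *m Z^T).
Proof.
move=> [_ posA]; apply: sumr_ge0 => i _.
have -> : (Z *m A *m Z^T) i i = (row i Z *m A *m (row i Z)^T) 0 0.
  rewrite -row_mul !mxE; apply: eq_bigr => j _.
  by rewrite !mxE.
exact: posA.
Qed.

Lemma psd_invmx_sym {R : realType} {m : nat} {A : 'M[R]_m} :
  psd A -> (invmx A)^T = invmx A.
Proof. by case=> symA _; rewrite trmx_inv symA. Qed.

Lemma trace_inv_ge0 {R : realType} {m : nat} {A : 'M[R]_m} :
  psd A -> (0 <= trace_inv A)%E.
Proof.
move=> pA; rewrite /trace_inv; case: ifP => // uA; rewrite lee_fin.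
(* Uses [A^-1 = A^-1 A (A^-1)^T]. *)
by have := psd_trace_ge0 (invmx A) pA; rewrite psd_invmx_sym // mulVmx // mul1mx.
Qed.

Lemma psd_mxsub_trace_inv {R : realType} {m p : nat} (A : 'M[R]_m)
    (f : 'I_p -> 'I_m) :
  injective f -> psd A -> A \in unitmx -> psd (mxsub f f A) ->
  (trace_inv (mxsub f f A) <= (\sum_i invmx A (f i) (f i))%:E)%E.
Proof.
move=> injf pA uA pB; set B := mxsub f f A in pB *.
pose E : 'M[R]_(p, m) := rowsub f 1%:M.
have subE (C : 'M[R]_m) : mxsub f f C = E *m C *m E^T.
  by rewrite trmx_mxsub trmx1 mulmx_colsub mulmx1 -rowsubE -mxsubcr.
have EE : E *m E^T = 1%:M.
  have := subE 1%:M; rewrite mulmx1 => <-; apply/matrixP => i j.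
  by rewrite !mxE (inj_eq injf).
have BE : B = E *m A *m E^T by exact: subE.
(* If [v B = 0], the form of [A] vanishes at [v E], so [v E = 0], and [E^T] is a right inverse of
   [E]. *)
have uB : B \in unitmx.
  rewrite -row_free_unit; apply: inj_row_free => v vB.
  have : v *m E = 0.
    apply: (psd_form_eq0 _ pA uA).
    have -> : v *m E *m A *m (v *m E)^T = v *m B *m v^T by rewrite BE trmx_mul !mulmxA.
    by rewrite vB mul0mx mxE.
  by move=> /(congr1 (mulmx^~ E^T)); rewrite mul0mx -mulmxA EE mulmx1.
rewrite /trace_inv uB lee_fin -subr_ge0.
have -> : \sum_i invmx A (f i) (f i) = \tr (E *m invmx A *m E^T).
  by rewrite -subE; apply: eq_bigr => i _; rewrite mxE.
rewrite -raddfB /=.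
(* Expanding, both cross terms are [- B^-1] and the last term is [B^-1 B B^-1 = B^-1]. *)
have := psd_trace_ge0 (E *m invmx A - invmx B *m E) pA.
congr (0 <= \tr _).
rewrite linearB /= !trmx_mul !psd_invmx_sym // mulmxBl.
rewrite mulmxKV // mulmxBl !mulmxBr.
rewrite -!mulmxA (mulmxA A) mulmxV // mul1mx EE mulmx1.
rewrite [E *m (E^T *m _)]mulmxA EE mul1mx.
have -> : E *m (A *m (E^T *m invmx B)) = 1%:M by rewrite !mulmxA -BE mulmxV.
by rewrite mulmx1 subrr subr0 mulmxA.
Qed.

Lemma expectation_bigsum {d : measure_display} {T : measurableType d}
    {R : realType} {P : probability T R} (I : finType) (F : I -> T -> R) :
  (forall i, F i \in Lfun P 1) ->
  ('E_P[fun t => (\sum_i F i t)%R] = \sum_i 'E_P[F i])%E.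
Proof.
move=> F1.
have := @expectation_sum _ _ _ P [seq F i | i <- index_enum I].
rewrite !big_map => <-; last by move=> _ /mapP[i _ ->].
by congr ('E_P[_])%E; apply/funext => t; rewrite fct_sumE.
Qed.

(** The form at [x] is the expectation of the square of the combination of the variables with
    coefficients [x]. Square integrability makes all products integrable, so [fine] commutes with
    the finite sums. *)
Lemma cov_sub_psd {d : measure_display} {T : measurableType d} {R : realType}
    {P : probability T R} {X : nat -> {RV P >-> R}}
    (X_L2 : forall i, (X i : T -> R) \in Lfun P 2%:E)
    {n : nat} (S : {set 'I_n}) :
  psd (cov_sub X S).
Proof.
split.
  apply/matrixP => i j; rewrite !mxE; congr (fine ('E_P[_])%E).
  by apply/funext => t; rewrite mulrC.
move=> x.
pose Y (i : 'I_#|S|) : T -> R := X (enum_val i).+1.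
have YY i j : (fun t => Y i t * Y j t) \in Lfun P 1.
  exact: (Lfun2_mul_Lfun1 (X_L2 _) (X_L2 _)).
pose F (ij : 'I_#|S| * 'I_#|S|) : T -> R :=
  (x 0 ij.1 * x 0 ij.2) \o* (fun t => Y ij.1 t * Y ij.2 t).
have F1 ij : F ij \in Lfun P 1.
  by apply: Lfun_scale => //; exact: YY.
suff -> : (x *m cov_sub X S *m x^T) 0 0
    = fine ('E_P[fun t => ((\sum_i x 0 i * Y i t) ^+ 2)%R])%E.
  by apply: fine_ge0; apply: expectation_ge0 => t; exact: sqr_ge0.
have -> : (fun t => (\sum_i x 0 i * Y i t) ^+ 2) = (fun t => \sum_ij F ij t).
  apply/funext => t; rewrite expr2 big_distrlr /= pair_bigA /=.
  by apply: eq_bigr => ij _; rewrite /F /=; ring.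
rewrite expectation_bigsum // -sum_fine; last first.
  by move=> ij _; exact: expectation_fin_num.
rewrite mxE -(pair_bigA _ (fun i j => fine ('E_P[F (i, j)])%E)) /= exchange_big /=.
apply: eq_bigr => j _; rewrite !mxE mulr_suml; apply: eq_bigr => i _.
rewrite mxE expectationZl // fineM ?expectation_fin_num //=.
by rewrite /Y; ring.
Qed.

(** Matrices over different subsets have different index types; [f] sends a position in [S'] to the
    position of the same element in [S]. The element [s0] only supplies the default of
    [enum_rank_in]. *)
Lemma cov_sub_mxsub {d : measure_display} {T : measurableType d}
    {R : realType} {P : probability T R} (X : nat -> {RV P >-> R})
    {n : nat} {S S' : {set 'I_n}} {s0 : 'I_n} (s0S : s0 \in S) :
  S' \subset S ->
  let f (i : 'I_#|S'|) := enum_rank_in s0S (enum_val i) in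
  injective f /\ cov_sub X S' = mxsub f f (cov_sub X S).
Proof.
move=> /fintype.subsetP sub f.
have fK i : enum_val (f i) = enum_val i.
  by rewrite enum_rankK_in //; exact/sub/enum_valP.
split; first by move=> i j fij; apply: enum_val_inj; rewrite -!fK fij.
by apply/matrixP => i j; rewrite !mxE !fK.
Qed.

Lemma sum_trace_inv_del {d : measure_display} {T : measurableType d}
    {R : realType} {P : probability T R} {X : nat -> {RV P >-> R}}
    (X_L2 : forall i, (X i : T -> R) \in Lfun P 2%:E)
    {n k : nat} (k_gt0 : (0 < k)%N) (S : {set 'I_n}) :
  #|S| = k.+1 ->
  (\sum_(s in S) trace_inv (cov_sub X (S :\ s))
     <= k%:R%:E * trace_inv (cov_sub X S))%E.
Proof.
move=> cS.
have [uS|nuS] := boolP (cov_sub X S \in unitmx); last first.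
  (* Here [k > 0] matters: the bound is [k * +oo = +oo], whereas [0 * +oo = 0]. *)
  by rewrite {2}/trace_inv (negPf nuS) gt0_muley ?leey // lte_fin ltr0n.
have [s0 s0S] : exists s0, s0 \in S by apply/set0Pn; rewrite -card_gt0 cS.
pose g (a : 'I_n) : R := let i := enum_rank_in s0S a in invmx (cov_sub X S) i i.
have le_del s : s \in S ->
    (trace_inv (cov_sub X (S :\ s)) <= (\sum_(a in S :\ s) g a)%:E)%E.
  move=> sS; have [injf covE] := cov_sub_mxsub X s0S (subD1set S s).
  have pS' := cov_sub_psd X_L2 (S :\ s).
  rewrite covE in pS' *; rewrite big_enum_val /=.
  exact: psd_mxsub_trace_inv injf (cov_sub_psd X_L2 S) uS pS'.
apply: (@le_trans _ _ (\sum_(s in S) (\sum_(a in S :\ s) g a)%:E)%E).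
  exact: lee_sum.
rewrite sumEFin /trace_inv uS -EFinM lee_fin.
have -> : \tr (invmx (cov_sub X S)) = \sum_(a in S) g a.
  by rewrite big_enum_val; apply: eq_bigr => i _; rewrite /g enum_valK_in.
(* Each inner sum is the full trace minus [g s]; the [k + 1] of them add up to [k + 1] traces minus
   one. *)
have -> : \sum_(s in S) \sum_(a in S :\ s) g a
    = \sum_(s in S) (\sum_(a in S) g a - g s).
  apply: eq_bigr => s sS; rewrite [in RHS](big_setD1 s) //=.
  by rewrite addrAC subrr add0r.
by rewrite sumrB sumr_const cS mulrSr addrK mulr_natl.
Qed.

(** Double counting: removing [s] matches pairs with [s] in a [k+1]-set to pairs with [s] outside a
    [k]-set, and a [k]-set has [#|I| - k] outside elements. No subtraction in [V] is used, so [V]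
    may be the extended reals. *)
Lemma sum_card_del {V : nmodType} {I : finType} (k : nat) (h : {set I} -> V) :
  \sum_(S : {set I} | #|S| == k.+1) \sum_(s in S) h (S :\ s)
    = (\sum_(S : {set I} | #|S| == k) h S) *+ (#|I| - k).
Proof.
rewrite (exchange_big_dep predT) //= -sumrMnl.
transitivity (\sum_(s : I) \sum_(S : {set I} | (#|S| == k) && (s \notin S)) h S).
  apply: eq_bigr => s _.
  rewrite (reindex_onto (fun S => s |: S) (fun S => S :\ s)) /=; last first.
    by move=> S /andP[_ sS]; rewrite finset.setD1K.
  apply: eq_big => [S|S /andP[_ /eqP-> //]].
  have [sS|sS] := boolP (s \in S).
    rewrite andbF; apply/negP => /andP[_ /eqP/setP/(_ s)].
    by rewrite sS !inE eqxx.
  by rewrite finset.setU1K // eqxx setU11 cardsU1 sS add1n eqSS !andbT.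
rewrite (exchange_big_dep (fun S : {set I} => #|S| == k)) /=; last first.
  by move=> s S _ /andP[].
apply: eq_bigr => S /eqP cS.
under eq_bigl do rewrite cS eqxx /=.
rewrite sumr_const -cS -(cardsC S) addKn; congr (_ *+ _).
by apply: eq_card => s; rewrite !inE.
Qed.

Theorem theorem8 (d : measure_display) (T : measurableType d) (R : realType)
    (P : probability T R) (X : nat -> {RV P >-> R})
    (X_L2 : forall i, (X i : T -> R) \in Lfun P 2%:E)
    (X_mean0 : forall i, ('E_P[X i] = 0)%E)
    (n k : nat) (k_gt0 : (0 < k)%N) (k_lt_n : (k < n)%N) :
  (trace_inv_avg X n k <= trace_inv_avg X n k.+1)%E.
Proof.
pose tri (S : {set 'I_n}) := trace_inv (cov_sub X S).
have tri_ge0 S : (0 <= tri S)%E by exact/trace_inv_ge0/cov_sub_psd.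
have avgE m : trace_inv_avg X n m
    = (('C(n, m)%:R^-1 * m%:R^-1 : R)%:E * \sum_(S : {set 'I_n} | #|S| == m) tri S)%E.
  rewrite /trace_inv_avg -ge0_sume_distrr; last by move=> S _; exact: tri_ge0.
  by rewrite muleA EFinM.
have le_sum : ((n - k)%:R%:E * \sum_(S : {set 'I_n} | #|S| == k) tri S
    <= k%:R%:E * \sum_(S : {set 'I_n} | #|S| == k.+1) tri S)%E.
  have := sum_card_del k tri; rewrite card_ord mule_natl => ck.
  (* [enatmul] on the left of the goal is convertible to [GRing.natmul] in [ck] *)
  rewrite -[X in (X <= _)%E]ck.
  rewrite ge0_sume_distrr //; apply: lee_sum => S /eqP cS.
  exact: sum_trace_inv_del.
have nk_gt0 : (0 : R) < (n - k)%:R by rewrite ltr0n subn_gt0.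
have k0 : (0 : R) < k%:R by rewrite ltr0n.
have Ck : (0 : R) < 'C(n, k)%:R by rewrite ltr0n bin_gt0 ltnW.
have binE : k.+1%:R * 'C(n, k.+1)%:R = (n - k)%:R * 'C(n, k)%:R :> R.
  by rewrite -!natrM mul_bin_left.
(* Common factor of both averages: [a (n - k)] normalizes level [k], and by [binE], [a k] normalizes
   level [k + 1]. *)
pose a : R := 'C(n, k)%:R^-1 * k%:R^-1 * (n - k)%:R^-1.
have -> : trace_inv_avg X n k
    = (a%:E * ((n - k)%:R%:E * \sum_(S : {set 'I_n} | #|S| == k) tri S))%E.
  by rewrite avgE muleA -EFinM divfK ?gt_eqF.
have -> : trace_inv_avg X n k.+1
    = (a%:E * (k%:R%:E * \sum_(S : {set 'I_n} | #|S| == k.+1) tri S))%E.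
  rewrite avgE muleA -EFinM -invfM mulrC binE /a.
  by congr (_%:E * _)%E; field; rewrite !gt_eqF.
by rewrite lee_pmul2l // lte_fin !mulr_gt0 ?invr_gt0.
Qed.
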